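(* Let $H$ be a fixed graph with chromatic number $\chi(H)=3$, and let $g\ge 2$ be the smallest integer such that there is no graph homomorphism $H\to C_{2g+1}$. For every $\varepsilon>0$, there exist constants $C>0$, $\rho>0$ and $n_0$ (depending only on $H$ and $\varepsilon$) such that every $H$-free graph $G$ on $n\ge n_0$ vertices with $$\delta(G)\ge\left(\frac{2}{2g+1}+\varepsilon\right)n$$ satisfies $\gamma_2(G)\le C n^{2-\rho}$.
   Context: All graphs are finite and simple. $\delta(G)$ is the minimum degree of $G$, and $C_\ell$ is the cycle of length $\ell$. A graph $G$ is $H$-free if it contains no (not necessarily induced) subgraph isomorphic to $H$. For a graph $G$ and $X\subseteq V(G)$, $G[X]$ is the induced subgraph on $X$ and $e(\cdot)$ counts edges; define $$\gamma_2(G)=\min_{V(G)=X\cup Y}\bigl(e(G[X])+e(G[Y])\bigr),$$ the minimum being over partitions of $V(G)$ into two (possibly empty) parts $X,Y$; equivalently, $\gamma_2(G)$ is the minimum number of edges that must be deleted from $G$ to make it bipartite. *)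

(* Defs.v *)
From mathcomp Require Import all_boot.

Set Implicit Arguments.
Unset Strict Implicit.
Unset Printing Implicit Defensive.

Record sgraph : Type := SGraph {
  vertex :> finType;
  adj : rel vertex;
  adj_sym : symmetric adj;
  adj_irr : irreflexive adj
}.

Definition edges (G : sgraph) : {set {set G}} :=
  [set [set p.1; p.2] | p : G * G & adj p.1 p.2].

Definition deg (G : sgraph) (x : G) : nat := #|[set y | adj x y]|.

(* Every degree is less than #|G|, so the default value #|G| only matters for
   the graph without vertices (where it is 0). *)
Definition min_deg (G : sgraph) : nat := \big[minn/#|G|]_(x : G) deg x.

Section Induced.
Variables (G : sgraph) (X : {set G}).

Definition induced_adj : rel {x : G | x \in X} :=
  fun x y => adj (val x) (val y).

Lemma induced_sym : symmetric induced_adj.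
Proof. by move=> x y; rewrite /induced_adj adj_sym. Qed.

Lemma induced_irr : irreflexive induced_adj.
Proof. by move=> x; rewrite /induced_adj adj_irr. Qed.

Definition induced : sgraph := SGraph induced_sym induced_irr.

End Induced.

Section Cycle.
Variable l : nat.

Definition cycle_adj : rel 'I_l :=
  fun i j => (i != j) && ((j == ordS i) || (i == ordS j)).

Lemma cycle_sym : symmetric cycle_adj.
Proof. by move=> i j; rewrite /cycle_adj eq_sym orbC. Qed.

Lemma cycle_irr : irreflexive cycle_adj.
Proof. by move=> i; rewrite /cycle_adj eqxx. Qed.

(* The cycle with l vertices when 3 <= l. *)
Definition cycle_graph : sgraph := SGraph cycle_sym cycle_irr.

End Cycle.

Definition is_hom (G H : sgraph) (f : G -> H) : Prop :=
  forall x y, adj x y -> adj (f x) (f y).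

Definition has_hom (G H : sgraph) : Prop := exists f : G -> H, is_hom f.

(* The subgraphs of G isomorphic to H are the images of the injective
   homomorphisms from H to G. *)
Definition has_subgraph (H G : sgraph) : Prop :=
  exists2 f : H -> G, injective f & is_hom f.

Definition is_free (H G : sgraph) : Prop := ~ has_subgraph H G.

Definition colorable (G : sgraph) (k : nat) : bool :=
  [exists c : {ffun G -> 'I_k},
    [forall x, forall y, adj x y ==> (c x != c y)]].

Lemma colorable_ex (G : sgraph) : exists k, colorable G k.
Proof.
exists #|G|; apply/existsP; exists [ffun x => enum_rank x].
apply/forallP => x; apply/forallP => y; apply/implyP => xy.
rewrite !ffunE (inj_eq enum_rank_inj).
by apply: contraTneq xy => ->; rewrite adj_irr.
Qed.

Definition chromatic_number (G : sgraph) : nat := ex_minn (colorable_ex G).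

(* The two parts of the partition are X and ~: X. *)
Definition cut_deficit (G : sgraph) (X : {set G}) : nat :=
  #|edges (induced X)| + #|edges (induced (~: X))|.

Definition gamma2 (G : sgraph) : nat :=
  cut_deficit [arg min_(X < (set0 : {set G})) cut_deficit X].

(* Main.v *)
(* If the minimum degree exceeds [2 n / (2 g + 1)] by a linear amount, then among any [g + 1] vertices two have linearly many common neighbours, and an odd closed
   walk of length at least [2 g + 1] has linearly many vertices adjacent to three of
   its positions, through each of which it can be shortened by at least 2.
   Put [m = n ^ (1 / Q)] for a large constant [Q], and suppose that [gamma2 G] is
   larger than [n ^ 2 / m]. A random list [U] of [m] vertices dominates almost all
   vertices, and a further random list [W] of [m] vertices joins any [g + 1] vertices
   of [U] enough for the graph on [U] and [W] to have at most [2 ^ g] proper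
   2-colorings. Each of these extends to a cut of [G], which leaves [n ^ 2 / m] edges
   inside its parts, so a random pair of vertices kills a given coloring with probability
   of order at least [1 / m]. After [2 ^ g] pairs no coloring survives, so there is an
   odd closed walk of bounded length, which boundedly many random vertices shorten to
   length at most [2 g - 1]. Hence, for some odd [l <= 2 g - 1], [G] has at least
   [n ^ l / m ^ q] cycles of length [l]; by the Kovari-Sos-Turan-Erdos argument they
   contain a blow-up of [C_l], and with it [H], as [H] maps to [C_l] by the minimality
   of [g]. *)
Require Import Defs.
From mathcomp Require Import all_boot all_order all_algebra.
From mathcomp Require Import reals exp boolp zify ring.

Set Implicit Arguments.
Unset Strict Implicit.
Unset Printing Implicit Defensive.

(** * Sums over lists of vertices *)

Lemma bernoulli_exp k n : n.+1 * k ^ n + k ^ n.+1 <= k.+1 ^ n.+1.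
Proof.
elim: n => [|n IH]; first by rewrite !expn1 expn0 muln1.
rewrite [k.+1 ^ _]expnS.
apply: leq_trans (leq_mul (leqnn _) IH).
by rewrite ![k ^ _.+1]expnS; nia.
Qed.

Section Words.
Variable V : finType.

(** Each list of length [k] occurs exactly once, so a sum over [words k] divided by [#|V| ^ k] is an
    average over random lists with independent uniform entries. Probabilities appear in this form,
    cleared of denominators. *)
Fixpoint words (k : nat) : seq (seq V) :=
  if k is k'.+1 then [seq v :: t | t <- words k', v <- enum V] else [:: [::]].

Lemma sum_wordsS k (F : seq V -> nat) :
  \sum_(t <- words k.+1) F t = \sum_(t <- words k) \sum_v F (v :: t).
Proof.
rewrite /= big_allpairs_dep /=; apply: eq_bigr => t _.
by rewrite big_enum.
Qed.

(** Exposes a random list in two stages: first the tail [t], then the entries put in front of it. *)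
Lemma sum_words_cat j k (F : seq V -> nat) :
  \sum_(t <- words (j + k)) F t =
  \sum_(t <- words k) \sum_(t' <- words j) F (t' ++ t).
Proof.
elim: j F => [|j IH] F.
  by apply: eq_bigr => t _; rewrite /= big_seq1.
rewrite addSn sum_wordsS IH; apply: eq_bigr => t _.
by rewrite sum_wordsS.
Qed.

Lemma size_words k : size (words k) = #|V| ^ k.
Proof.
elim: k => [//|k IH].
by rewrite /= size_allpairs IH -cardE expnSr.
Qed.

Lemma mem_words k t : (t \in words k) = (size t == k).
Proof.
elim: k t => [|k IH] t; first by rewrite inE; case: t.
apply/allpairsP/eqP => [[[u v] /= [ut _ ->]]|].
  by move: ut; rewrite IH /= => /eqP->.
case: t => [//|v t] [st]; exists (t, v); split => //=.
  by rewrite IH st.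
by rewrite mem_enum.
Qed.

Lemma sum_words_const k c : \sum_(t <- words k) c = #|V| ^ k * c.
Proof. by rewrite big_const_seq count_predT size_words iter_addn_0 mulnC. Qed.

Lemma sum_words_all k (P : pred V) :
  \sum_(t <- words k) all P t = #|P| ^ k.
Proof.
elim: k => [|k IH]; first by rewrite big_seq1.
rewrite sum_wordsS expnSr -IH big_distrl /=; apply: eq_bigr => t _.
under eq_bigr do rewrite /= -mulnb.
rewrite -big_distrl mulnC /=; congr (_ * _).
by rewrite -sum1_card [RHS]big_mkcond; apply: eq_bigr => v _; rewrite unfold_in; case: (P v).
Qed.

Lemma sum_words_half k (P : pred (seq V)) :
  4 * \sum_(t <- words k) ~~ P t <= #|V| ^ k -> #|V| ^ k <= 2 * \sum_(t <- words k) P t.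
Proof.
have -> : #|V| ^ k = \sum_(t <- words k) P t + \sum_(t <- words k) ~~ P t.
  rewrite -big_split /= -[LHS]muln1 -sum_words_const.
  by apply: eq_bigr => t _; case: (P t).
by set a := (X in _ <= X + _ -> _); set b := (X in _ <= _ + X -> _); lia.
Qed.

Lemma sum_not_uniq_words k :
  #|V| * \sum_(t <- words k) ~~ uniq t <= k ^ 2 * #|V| ^ k.
Proof.
elim: k => [|k IH]; first by rewrite big_seq1 /= muln0.
have: \sum_(t <- words k.+1) ~~ uniq t <=
      \sum_(t <- words k) (k + #|V| * ~~ uniq t).
  rewrite sum_wordsS big_seq [leqRHS]big_seq; apply: leq_sum => t.
  rewrite mem_words => /eqP st.
  apply: (@leq_trans (\sum_v ((v \in t) + ~~ uniq t))).
    by apply: leq_sum => v _ /=; case: (v \in t); case: (uniq t).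
  rewrite big_split /= sum_nat_const leq_add2r -st.
  apply: leq_trans (card_size t); rewrite -sum1_card [leqRHS]big_mkcond.
  by apply: leq_sum => v _; case: (v \in t).
rewrite big_split /= sum_words_const -big_distrr /= => h.
apply: leq_trans (leq_mul (leqnn _) h) _.
rewrite [#|V| ^ k.+1]expnS; move: IH; set x := #|V| ^ k; set S := \sum_(t <- _) _ => IH.
apply: (@leq_trans (#|V| * (x * k + k ^ 2 * x))); first by rewrite leq_mul2l leq_add2l IH orbT.
rewrite [leqRHS]mulnCA leq_mul2l; apply/orP; right; nia.
Qed.

(** Induction on [k]: the first entry either is some [v] in [c], which leaves [rem v c] to the tail,
    or leaves all of [c] to it. The recursion closes by [bernoulli_exp]. *)
Lemma sum_words_sub k (c : seq V) : uniq c ->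
  #|V| ^ size c * \sum_(t <- words k) all (mem t) c <= k ^ size c * #|V| ^ k.
Proof.
move: {-1}(size c) (erefl (size c)) => n.
elim: k n c => [|k IH] n c sc uc.
  rewrite big_seq1; case: c sc uc => [|x c] <- //= _; by rewrite muln0.
have h (t : seq V) v : all (mem (v :: t)) c <=
     (v \in c) * all (mem t) (rem v c) + all (mem t) c.
  case: (boolP (all (mem (v :: t)) c)) => // /allP vt.
  case: (boolP (v \in c)) => vc /=.
    rewrite mul1n; suff -> : all (mem t) (rem v c) by [].
    apply/allP => x; rewrite mem_rem_uniq // => /andP[/= xv /vt].
    by rewrite /= inE (negPf xv).
  suff -> : all (mem t) c by [].
  apply/allP => x xc; move: (vt x xc); rewrite /= inE => /orP[/eqP xv|//].
  by rewrite -xv xc in vc.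
rewrite sum_wordsS.
apply: (@leq_trans (#|V| ^ n * (\sum_(v in c) \sum_(t <- words k) all (mem t) (rem v c)
   + \sum_(t <- words k) #|V| * all (mem t) c))).
  rewrite leq_mul2l; apply/orP; right.
  rewrite exchange_big /= [X in _ <= X + _]big_mkcond -[#|V|]sum1_card.
  under [X in _ <= _ + X]eq_bigr do rewrite big_distrl /=.
  rewrite [X in _ <= _ + X]exchange_big /= -big_split /=.
  apply: leq_sum => v _; rewrite -(mul1n (if _ then _ else _)).
  apply: (@leq_trans (\sum_(t <- words k) ((v \in c) * all (mem t) (rem v c) + all (mem t) c))).
    by apply: leq_sum => t _; apply: h.
  rewrite big_split /= leq_add //; last first.
    by apply: leq_sum => t _; rewrite mul1n.
  rewrite -big_distrr /= mul1n; by case: (v \in c); rewrite ?mul1n ?mul0n.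
rewrite -big_distrr /= mulnDr [#|V| ^ n * (#|V| * _)]mulnCA.
have {}IH2 := IH _ _ sc uc.
case: n sc IH2 => [|n] sc IH2.
  case: c sc {uc h} IH2 => // _ IH2.
  rewrite big_pred0 // muln0 add0n.
  by rewrite !mul1n in IH2 *; rewrite expnS leq_mul2l IH2 orbT.
have IH1 : #|V| ^ n.+1 * (\sum_(v in c) \sum_(t <- words k) all (mem t) (rem v c))
   <= #|V| * (n.+1 * (k ^ n * #|V| ^ k)).
  rewrite expnS -mulnA leq_mul2l; apply/orP; right.
  rewrite big_distrr /= -[in leqRHS]sc -(card_uniqP uc) -sum_nat_const.
  apply: leq_sum => v vc.
  apply: IH; last exact: rem_uniq.
  by rewrite size_rem // sc.
apply: leq_trans (leq_add IH1 (leq_mul (leqnn _) IH2)) _.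
rewrite -mulnDr [#|V| ^ k.+1]expnS [in leqRHS]mulnCA leq_mul2l; apply/orP; right.
rewrite mulnA -mulnDl leq_mul2r; apply/orP; right.
rewrite !expnS.
by rewrite -!expnS; apply: bernoulli_exp.
Qed.

Lemma power_mean (I : Type) (r : seq I) (a : I -> nat) h :
  (\sum_(i <- r) a i) ^ h.+1 <= size r ^ h * \sum_(i <- r) a i ^ h.+1.
Proof.
elim: h => [|h IH]; first by rewrite !expn1 mul1n.
(* Chebyshev's sum inequality: once doubled, it holds for each pair [i], [j], because [a i] and
   [a i ^ h.+1] are ordered in the same way. *)
have cheb : (\sum_(i <- r) a i) * (\sum_(i <- r) a i ^ h.+1) <=
            size r * \sum_(i <- r) a i ^ h.+2.
  rewrite -(leq_pmul2l (isT : 0 < 2)) !mul2n -!addnn.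
  rewrite {2}[(\sum_(i <- r) a i) * _]mulnC !big_distrlr /=.
  have -> : size r * (\sum_(i <- r) a i ^ h.+2) + size r * (\sum_(i <- r) a i ^ h.+2)
     = \sum_(i <- r) \sum_(j <- r) (a i ^ h.+2 + a j ^ h.+2).
    under [RHS]eq_bigr do rewrite big_split /= big_const_seq count_predT iter_addn_0.
    by rewrite big_split /= big_const_seq count_predT iter_addn_0 -big_distrl
      /= mulnC [X in _ + X]mulnC.
  rewrite -big_split /=; apply: leq_sum => i _; rewrite -big_split /=.
  apply: leq_sum => j _; rewrite ![_ ^ h.+2]expnS.
  case: (leqP (a i) (a j)) => [ij|/ltnW ij].
    have: a i ^ h.+1 <= a j ^ h.+1 by rewrite leq_exp2r.
    nia.
  have: a j ^ h.+1 <= a i ^ h.+1 by rewrite leq_exp2r.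
  nia.
rewrite expnS; apply: leq_trans (leq_mul (leqnn _) IH) _.
rewrite mulnCA [size r ^ h.+1]expnSr -mulnA leq_mul2l cheb orbT //.
Qed.

End Words.

(** * Blow-ups from dense sets of lists *)

(** By the power mean inequality over [x], a random list [vs] has many common extensions on average.
    As [#|V|] is large, lists with repeated entries account for less than half of the bound, so some
    [uniq] list has many. *)
Lemma kst_step (V : finType) (A : pred (seq V)) l h M :
  2 * (M * h.+1 ^ 2) < #|V| ->
  #|V| ^ (l.+1 * h.+1) <= M * (\sum_(t <- words V l.+1) A t) ^ h.+1 ->
  exists vs : seq V, [/\ uniq vs, size vs = h.+1 &
    #|V| ^ l <= 2 * M * \sum_(x <- words V l) all (fun v => A (v :: x)) vs].
Proof.
move=> NM dense.
pose X vs := \sum_(x <- words V l) all (fun v => A (v :: x)) vs.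
have V0 : 0 < #|V| by apply: leq_ltn_trans NM.
have XM vs : X vs <= #|V| ^ l.
  rewrite -[leqRHS]muln1 -(sum_words_const V l 1); apply: leq_sum => x _.
  exact: leq_b1.
have {dense} dense : #|V| ^ (l + h.+1) <= M * \sum_(vs <- words V h.+1) X vs.
  have -> : \sum_(vs <- words V h.+1) X vs =
            \sum_(x <- words V l) (\sum_v A (v :: x)) ^ h.+1.
    rewrite exchange_big; apply: eq_bigr => x _.
    rewrite sum_words_all; congr (_ ^ _).
    by rewrite -sum1_card big_mkcond; apply: eq_bigr => v _; rewrite unfold_in; case: (A _).
  rewrite sum_wordsS in dense.
  have pm := power_mean (words V l) (fun x => \sum_v A (v :: x)) h.
  rewrite size_words -expnM in pm.
  rewrite -(@leq_pmul2l (#|V| ^ (l * h))) ?expn_gt0 ?V0 // -expnD.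
  have -> : l * h + (l + h.+1) = l.+1 * h.+1 by nia.
  apply: leq_trans dense _.
  by rewrite mulnCA leq_mul2l pm orbT.
case: (boolP (has (fun vs => uniq vs && (#|V| ^ l <= 2 * M * X vs)) (words V h.+1))).
  by case/hasP => vs; rewrite mem_words => /eqP svs /andP[uvs Xvs]; exists vs.
move=> /hasPn none; exfalso.
have nu := sum_not_uniq_words V h.+1.
have up : 2 * M * \sum_(vs <- words V h.+1) X vs <=
   #|V| ^ (l + h.+1) + 2 * M * #|V| ^ l * \sum_(vs <- words V h.+1) ~~ uniq vs.
  rewrite [l + _]addnC expnD -sum_words_const !big_distrr -big_split /=.
  rewrite big_seq [leqRHS]big_seq; apply: leq_sum => vs /none.
  rewrite negb_and -ltnNge; case: (uniq vs) => /= [/ltnW h1|_].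
    by rewrite muln0 addn0.
  by rewrite muln1 -{1}[_ * X vs]add0n leq_add // leq_mul2l XM orbT.
have: 2 * (#|V| * #|V| ^ (l + h.+1)) < 2 * (#|V| * #|V| ^ (l + h.+1)); last by rewrite ltnn.
apply: (@leq_ltn_trans (#|V| * (2 * M * \sum_(vs <- words V h.+1) X vs))).
  by rewrite mulnCA leq_mul2l -mulnA leq_mul2l dense !orbT.
apply: leq_ltn_trans (leq_mul (leqnn _) up) _.
rewrite mulnDr mul2n -addnn ltn_add2l mulnCA.
apply: leq_ltn_trans (leq_mul (leqnn _) nu) _.
rewrite expnD.
have p1 : 0 < #|V| ^ l * #|V| ^ h.+1 by rewrite muln_gt0 !expn_gt0 V0.
rewrite [ltnLHS](_ : _ = 2 * (M * h.+1 ^ 2) * (#|V| ^ l * #|V| ^ h.+1));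
  last by rewrite -!mulnA; nia.
by rewrite [ltnRHS]addn0 ltn_pmul2r.
Qed.

(** Induction on the number [l] of coordinates, with [kst_step] peeling off one. For positive [h]
    the density bound drops from [m ^ -q] to [m ^ -(q * h + 1)], the last factor [m] absorbing the 2
    of [kst_step]; it stays polynomial in [m]. *)
Lemma kst l h q : exists Q m0, forall (V : finType) (A : pred (seq V)) m,
  m0 <= m -> m ^ Q <= #|V| ->
  #|V| ^ l <= m ^ q * \sum_(t <- words V l) A t ->
  exists S : seq (seq V), [/\ size S = l,
    {in S, forall s, uniq s && (size s == h)} &
    forall x, all2 (fun v s => v \in s) x S -> A x].
Proof.
(* For [h = 0] the members of [S] are empty, so no [x] has to be checked unless [l = 0]. *)
case: h => [|h].
  exists 0, 0 => V A m _ _ dense; exists (nseq l [::]); split; first by rewrite size_nseq.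
    by move=> s /nseqP[->].
  case: l dense => [|l] dense; last by case.
  case=> // _; move: dense; rewrite /= big_seq1; by case: (A [::]); rewrite ?muln0.
elim: l q => [|l IH] q.
  exists 0, 0 => V A m _ _ dense; exists [::]; split => //.
  case=> // _; move: dense; rewrite /= big_seq1; by case: (A [::]); rewrite ?muln0.
have [Q [m0 HQ]] := IH (q * h.+1).+1.
exists (maxn Q (q * h.+1).+1), (maxn m0 (2 * h.+1 ^ 2).+1) => V A m.
rewrite geq_max => /andP[mm0 mh] mQ dense.
have m_gt0 : 0 < m by apply: leq_trans mh.
have [||vs [uvs svs dvs]] := @kst_step V A l h (m ^ (q * h.+1)).
- apply: leq_trans mQ; apply: (@leq_trans (m ^ (q * h.+1).+1)).
    by rewrite [ltnRHS]expnSr mulnCA ltn_pmul2l // expn_gt0 m_gt0.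
  by rewrite leq_pexp2l // leq_maxr.
- by rewrite !expnM -expnMn leq_exp2r.
have [||S [sS hS AS]] := HQ V (fun x => all (fun v => A (v :: x)) vs) m mm0.
- by apply: leq_trans mQ; rewrite leq_pexp2l // leq_maxl.
- apply: leq_trans dvs _; rewrite leq_mul2r; apply/orP; right.
  by rewrite expnS leq_mul2r; apply/orP; right; lia.
exists (vs :: S); split; first by rewrite /= sS.
  by move=> s; rewrite inE => /predU1P[->|/hS//]; rewrite uvs svs eqxx.
by case=> // v x /= /andP[vvs /AS/allP]; apply.
Qed.

Definition closed_seq (G : sgraph) (x : seq G) : Prop :=
  forall d i, i < size x -> adj (nth d x i) (nth d x (i.+1 %% size x)).

(** The members of [S] are the parts of a blow-up of [C_l]; a vertex [a] of [H] goes to the entry of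
    rank [enum_rank a] in part [f a]. *)
Lemma box_subgraph (H G : sgraph) l (f : H -> cycle_graph l) (S : seq (seq G)) :
  is_hom f -> size S = l ->
  {in S, forall s, uniq s && (size s == #|H|)} ->
  (forall x, all2 (fun v s => v \in s) x S -> uniq x /\ closed_seq x) ->
  has_subgraph H G.
Proof.
move=> homf sS hS AS.
case: (pickP (fun a : H => true)) => [a0 _|noH]; last first.
  have noH' : H -> False by move=> a; have := noH a.
  by exists (fun a => match noH' a with end) => a; case: (noH' a).
have l_gt0 : 0 < l by apply: leq_ltn_trans (ltn_ord (f a0)).
have inS i : i < l -> nth [::] S i \in S by move=> il; rewrite mem_nth ?sS.
have sz i : i < l -> size (nth [::] S i) = #|H|.
  by move=> il; have /andP[_ /eqP] := hS _ (inS i il).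
have d : G.
  have := sz _ (ltn_ord (f a0)); case: (nth _ S _) => [/esym/eqP|v _ _]; last exact: v.
  by rewrite -leqn0 leqNgt; move/negP=> h; exfalso; apply: h; apply/card_gt0P; exists a0.
pose F (a : H) := nth d (nth [::] S (f a)) (enum_rank a).
have FS a : F a \in nth [::] S (f a) by rewrite mem_nth // sz.
(* [F] preserves edges and is injective because any two of its values lie in a
   common selection. *)
pose x a b := mkseq (fun i => if i == f a :> nat then F a else
                     if i == f b :> nat then F b else nth d (nth [::] S i) 0) l.
have xS a b : uniq (x a b) /\ closed_seq (x a b).
  apply: AS; rewrite all2E size_mkseq sS eqxx /=.
  apply/(all_nthP (d, [::])) => i; rewrite size_zip size_mkseq sS minnn => il.
  rewrite nth_zip ?size_mkseq ?sS //= nth_mkseq //.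
  have [->|_] := eqVneq i (f a); first exact: FS.
  have [->|_] := eqVneq i (f b); first exact: FS.
  by rewrite mem_nth // sz //; apply/card_gt0P; exists a0.
exists F => [a b eqF|a b ab].
  have [fab|fab] := eqVneq (f a : nat) (f b).
    apply/enum_rank_inj/val_inj/eqP => /=.
    move: eqF; rewrite /F fab => /eqP.
    rewrite nth_uniq ?sz //.
    by have /andP[] := hS _ (inS _ (ltn_ord (f b))).
  exfalso; have [ux _] := xS a b.
  have := nth_uniq d _ _ ux; rewrite size_mkseq => /(_ (f a) (f b) (ltn_ord _) (ltn_ord _)).
  by rewrite !nth_mkseq // eqxx [_ == f a :> nat]eq_sym (negPf fab) eqxx eqF eqxx.
have adjF c e : f c != f e -> f e = ordS (f c) -> adj (F c) (F e).
  move=> ne fe; have [_ /(_ d (f c))] := xS c e; rewrite size_mkseq => /(_ (ltn_ord _)).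
  have -> : (f c).+1 %% l = f e by rewrite fe.
  by rewrite !nth_mkseq // eqxx [_ == f c :> nat]eq_sym (inj_eq val_inj) (negPf ne) eqxx.
have := homf _ _ ab; rewrite /= /cycle_adj => /andP[ne /orP[/eqP e|/eqP e]].
  exact: adjF.
by rewrite adj_sym; apply: adjF => //; rewrite eq_sym.
Qed.

(** * Odd closed walks *)

Section Walks.
Variable G : sgraph.
Implicit Types (S T : {set G}) (x y : G) (t : nat -> G).

(** Only the values of [t] up to [k] matter; walks are then cut, shifted and reversed by arithmetic
    on indices. *)
Definition is_walk S k t : Prop :=
  (forall i, i <= k -> t i \in S) /\ (forall i, i < k -> adj (t i) (t i.+1)).

Definition walk S k x y : Prop := exists t, [/\ t 0 = x, t k = y & is_walk S k t].

Definition odd_closed_walk S k : Prop := odd k /\ exists x, walk S k x x.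

Lemma walk0 S x : x \in S -> walk S 0 x x.
Proof. by move=> xS; exists (fun _ => x). Qed.

Lemma walk1 S x y : x \in S -> y \in S -> adj x y -> walk S 1 x y.
Proof.
move=> xS yS xy; exists (fun i => if i is 0 then x else y); split => //.
by split => [[|i]|[|i]].
Qed.

Lemma walk_cat S j k x y z : walk S j x y -> walk S k y z -> walk S (j + k) x z.
Proof.
case=> t [<- tj [tS ta]] [u [u0 <- [uS ua]]].
exists (fun i => if i <= j then t i else u (i - j)); split => //.
  case: leqP => [h|_]; last by rewrite addKn.
  have k0 : k = 0 by lia.
  by rewrite k0 addn0 u0.
split => i ik.
  by case: leqP => h; [apply: tS | apply: uS; lia].
case: (leqP i j) => h; case: (leqP i.+1 j) => h'.
- exact: ta.
- have ij : i = j by lia.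
  by rewrite ij subSnn tj -u0; apply: ua; lia.
- lia.
- by rewrite subSn; [apply: ua; lia | lia].
Qed.

Lemma walk_sym S k x y : walk S k x y -> walk S k y x.
Proof.
case=> t [<- <- [tS ta]]; exists (fun i => t (k - i)); rewrite subn0 subnn; split => //.
split => i ik; first by apply: tS; lia.
rewrite adj_sym (_ : k - i = (k - i.+1).+1); last by lia.
by apply: ta; lia.
Qed.

Lemma walk_sub S k t i j : is_walk S k t -> i <= j <= k -> walk S (j - i) (t i) (t j).
Proof.
move=> [tS ta] /andP[ij jk]; exists (fun l => t (i + l)); rewrite addn0 subnKC //; split => //.
by split => l lk; [apply: tS; lia | rewrite addnS; apply: ta; lia].
Qed.

Lemma walkS S T k x y : S \subset T -> walk S k x y -> walk T k x y.
Proof.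
by move=> /subsetP ST [t [t0 tk [tS ta]]]; exists t; split => //; split => // i /tS /ST.
Qed.

Lemma odd_closed_walkS S T k :
  S \subset T -> odd_closed_walk S k -> odd_closed_walk T k.
Proof. by move=> ST [ok [x w]]; split => //; exists x; apply: walkS w. Qed.

(* The lengths of the two closed walks add up to [k + 2 * p], which is odd. *)
Lemma odd_closed_walk_split S k t i j p :
  is_walk S k t -> t k = t 0 -> odd k -> i <= j <= k -> walk S p (t i) (t j) ->
  odd_closed_walk S (j - i + p) \/ odd_closed_walk S (k - (j - i) + p).
Proof.
move=> tw tk ok ijk wp.
have w1 : walk S (j - i + p) (t i) (t i).
  by apply: walk_cat (walk_sym wp); apply: walk_sub ijk.
have w2 : walk S (k - (j - i) + p) (t j) (t j).
  rewrite (_ : k - (j - i) = (k - j) + (i - 0)); last by lia.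
  apply: walk_cat wp; apply: walk_cat (_ : walk S _ (t j) (t k)) _.
    by apply: walk_sub tw _; lia.
  by rewrite tk; apply: walk_sub tw _; lia.
case: (boolP (odd (j - i + p))) => o; [left|right]; split => //; try by eexists; eassumption.
lia.
Qed.

(** At a repeated vertex the closed walk splits into two shorter ones, of which one is odd. *)
Lemma odd_closed_walk_inj S k : odd_closed_walk S k ->
  exists k' t, [/\ k' <= k, odd k', is_walk S k' t, t k' = t 0 &
    forall i j, i < j < k' -> t i != t j].
Proof.
elim/ltn_ind: k => k IH [ok [x [t [t0 tk tw]]]].
have [inj|] := pselect (forall i j, i < j < k -> t i != t j).
  by exists k, t; rewrite tk.
move=> /existsNP[i /existsNP[j /not_implyP[ijk /negP]]]; rewrite negbK => /eqP tij.
have wij : walk S 0 (t i) (t j).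
  by rewrite tij; apply: walk0; case: tw => tS _; apply: tS; lia.
have tkt : t k = t 0 by rewrite tk.
have ijk' : i <= j <= k by lia.
by case: (odd_closed_walk_split tw tkt ok ijk' wij) => /IH[|k' [u [k'le ? ? ? ?]]];
  [lia | exists k', u; split => //; lia | lia | exists k', u; split => //; lia].
Qed.

(** The three positions cut the closed walk into arcs with total length [k]. If no detour through
    [w] saved 2, each arc would have length 2 or be odd of length at least [k - 2]. As [k] is odd,
    some arc is odd; the other two then have length 1, which is neither 2 nor at least [k - 2]. *)
Lemma odd_closed_walk_shorten S k t w i j l :
  5 <= k -> is_walk S k t -> t k = t 0 -> odd k -> i < j < l -> l < k ->
  w \in S -> adj (t i) w -> adj (t j) w -> adj (t l) w ->
  exists2 k', k' <= k - 2 & odd_closed_walk S k'.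
Proof.
move=> k5 tw tk ok ijl lk wS iw jw lw.
have w2 a b : a < b < k -> adj (t a) w -> adj (t b) w -> walk S 2 (t a) (t b).
  move=> abk aw bw; have [tS _] := tw.
  apply: (@walk_cat S 1 1 _ w); first by apply: walk1 => //; apply: tS; lia.
  by rewrite adj_sym in bw; apply: walk1 => //; apply: tS; lia.
have split2 a b : a < b < k -> adj (t a) w -> adj (t b) w ->
    odd_closed_walk S (b - a + 2) \/ odd_closed_walk S (k - (b - a) + 2).
  by move=> abk aw bw; apply: odd_closed_walk_split (w2 a b abk aw bw) => //; lia.
apply: contrapT => none.
have long c : odd_closed_walk S c -> odd c /\ k - 2 < c.
  move=> oc; split; first by case: oc.
  by rewrite ltnNge; apply/negP => ck; apply: none; exists c.
have ijk : i < j < k by lia.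
have jlk : j < l < k by lia.
have ilk : i < l < k by lia.
by case: (split2 i j ijk iw jw) => /long[? ?]; case: (split2 j l jlk jw lw) => /long[? ?];
  case: (split2 i l ilk iw lw) => /long[? ?]; lia.
Qed.

End Walks.

(** * Degrees and 2-colorings *)

Lemma min_deg_le (G : sgraph) (x : G) : min_deg G <= deg x.
Proof.
rewrite /min_deg; have: x \in index_enum G by rewrite mem_index_enum.
elim: (index_enum G) => [//|y r IH]; rewrite inE big_cons.
by case/predU1P => [->|/IH]; [exact: geq_minl | apply: leq_trans; exact: geq_minr].
Qed.

Section Degrees.
Variables (G : sgraph) (g e : nat).
(** The bound [deg x >= (2 / (2 * g + 1) + 1 / e) * #|G|], cleared of denominators. *)
Hypothesis min_degree : forall x : G, (2 * e + (2 * g + 1)) * #|G| <= (2 * g + 1) * e * deg x.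

(** Double counting: a vertex outside the set contributes at most [j] to the sum of the degrees, any
    other at most [#|I|], while the sum exceeds [j * #|G|] by at least [#|I| * #|G| / e]. The cases
    needed are [j = 0] for a single vertex, [j = 1] for [g + 1] vertices, and [j = 2] for the
    positions of a closed walk of length at least [2 * g + 1]. *)
Lemma many_common_neighbours (I : finType) (t : I -> G) j :
  0 < #|I| -> j * (2 * g + 1) <= 2 * #|I| ->
  #|G| <= e * #|[set v | j < #|[set i | adj (t i) v]|]|.
Proof.
move=> I0 jI; set B := [set v | _].
have up : \sum_i deg (t i) <= j * #|G| + #|I| * #|B|.
  rewrite (eq_bigr (fun i => \sum_v (adj (t i) v : nat))); last first.
    move=> i _; rewrite /deg -sum1_card big_mkcond; apply: eq_bigr => v _.
    by rewrite inE; case: (adj _ _).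
  rewrite exchange_big /=.
  have -> : j * #|G| + #|I| * #|B| = \sum_(v : G) (j + #|I| * (v \in B)).
    rewrite big_split /= sum_nat_const mulnC -big_distrr /=; congr (_ + _ * _).
    by rewrite -sum1_card big_mkcond; apply: eq_bigr => v _; case: (v \in B).
  apply: leq_sum => v _.
  have -> : \sum_i (adj (t i) v : nat) = #|[set i | adj (t i) v]|.
    rewrite -sum1_card [RHS]big_mkcond; apply: eq_bigr => i _.
    by rewrite inE; case: (adj _ _).
  rewrite inE; case: (ltnP j _) => h; last by rewrite muln0 addn0.
  by rewrite muln1; apply: leq_trans (leq_addl _ _); apply: max_card.
have low : #|I| * ((2 * e + (2 * g + 1)) * #|G|) <= (2 * g + 1) * e * \sum_i deg (t i).
  rewrite -sum_nat_const big_distrr; apply: leq_sum => i _; exact: min_degree.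
have h : #|I| * ((2 * e + (2 * g + 1)) * #|G|) <=
         (2 * g + 1) * e * (j * #|G| + #|I| * #|B|).
  by apply: leq_trans low _; rewrite leq_mul2l up orbT.
have h2 : #|I| * (2 * g + 1) * #|G| <= #|I| * (2 * g + 1) * (e * #|B|).
  have : e * #|G| * (j * (2 * g + 1)) <= e * #|G| * (2 * #|I|) by rewrite leq_mul2l jI orbT.
  move: h; set a := #|I|; set n := #|G|; set b := #|B|; set c := 2 * g + 1; nia.
by move: h2; rewrite leq_pmul2l // muln_gt0 I0 addn1.
Qed.

Lemma linear_degree (x : G) : #|G| <= e * deg x.
Proof.
have := @many_common_neighbours unit (fun _ => x) 0; rewrite card_unit => /(_ isT isT).
set A := [set v | _]; suff -> : A = [set y | adj x y] by [].
apply/setP => v; rewrite !inE; case: (boolP (adj x v)) => xv.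
  by apply/card_gt0P; exists tt; rewrite inE.
by apply/negbTE; rewrite -eqn0Ngt cards_eq0; apply/eqP/setP => i; rewrite in_set.
Qed.

(** The entries are independent and each one misses [S] with probability at most [1 - 1 / e]. *)
Lemma sum_avoid (S : {set G}) k : #|G| <= e * #|S| ->
  e ^ k * \sum_(t <- words G k) all (fun v => v \notin S) t <= (e.-1 * #|G|) ^ k.
Proof.
move=> eS; rewrite sum_words_all -expnMn; case: k => [//|k].
rewrite leq_exp2r //.
have -> : #|(fun v : G => v \notin S)| = #|G| - #|S|.
  rewrite -(cardC (mem S)) addKn; apply: eq_card => v; by rewrite !inE.
by have := subset_leq_card (subsetT S); rewrite cardsT; nia.
Qed.

End Degrees.

Section Gamma.
Variable G : sgraph.

Lemma card_edges_induced (X : {set G}) :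
  #|edges (induced X)| <= #|[set p : G * G | [&& adj p.1 p.2, p.1 \in X & p.2 \in X]]|.
Proof.
apply: leq_trans (leq_imset_card _ _) _.
rewrite -(@card_in_imset _ _ (fun p : induced X * induced X => (val p.1, val p.2))).
  apply: subset_leq_card; apply/subsetP => q /imsetP[p].
  rewrite inE => ap ->; rewrite inE /=; apply/and3P.
  by split; [exact: ap | exact: (valP p.1) | exact: (valP p.2)].
by move=> [a b] [c d] _ _ [] /val_inj-> /val_inj->.
Qed.

(** Ordered pairs count every edge twice, which is harmless in an upper bound. *)
Lemma gamma2_le (X : {set G}) :
  gamma2 G <= #|[set p : G * G | adj p.1 p.2 && ((p.1 \in X) == (p.2 \in X))]|.
Proof.
rewrite /gamma2; case: arg_minnP => // Y _ /(_ X isT)/leq_trans; apply.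
apply: leq_trans (leq_add (card_edges_induced _) (card_edges_induced _)) _.
rewrite -cardsUI [X in _ + X](_ : _ = 0) ?addn0; last first.
  apply/eqP; rewrite cards_eq0; apply/eqP/setP => p; rewrite !inE.
  by case: (adj _ _); case: (p.1 \in X); case: (p.2 \in X).
apply: subset_leq_card; apply/subsetP => p; rewrite !inE.
by case: (adj _ _); case: (p.1 \in X); case: (p.2 \in X).
Qed.

End Gamma.

Section Colorings.
Variable G : sgraph.
Implicit Types (S T U A : {set G}).

(* A proper 2-coloring of [G[T]], given by one of its color classes. *)
Definition bicolorings T : {set {set G}} :=
  [set A : {set G} | (A \subset T) &&
    [forall x in T, forall y in T, adj x y ==> ((x \in A) != (y \in A))]].

Lemma bicoloringsP T A :
  reflect (A \subset T /\ {in T &, forall x y, adj x y -> (x \in A) = ~~ (y \in A)})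
          (A \in bicolorings T).
Proof.
rewrite inE; apply: (iffP andP) => -[AT h]; split => //.
  move=> x y xT yT xy; move/forall_inP: h => /(_ x xT)/forall_inP/(_ y yT)/implyP/(_ xy).
  by case: (x \in A); case: (y \in A).
apply/forall_inP => x xT; apply/forall_inP => y yT; apply/implyP => xy.
by rewrite (h x y xT yT xy); case: (y \in A).
Qed.

Definition dominated U : {set G} := [set x | [exists u in U, adj x u]].

Lemma dominatedP U x : reflect (exists2 u, u \in U & adj x u) (x \in dominated U).
Proof. by rewrite inE; apply: (iffP exists_inP). Qed.

Lemma bicolorings_eqI U T A B : U \subset T -> T \subset U :|: dominated U ->
  A \in bicolorings T -> B \in bicolorings T -> {in U, A =i B} -> A = B.
Proof.
move=> /subsetP UT /subsetP TUD /bicoloringsP[/subsetP AT Ac] /bicoloringsP[/subsetP BT Bc] UAB.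
apply/setP => x; case: (boolP (x \in T)) => xT; last first.
  by rewrite (contraNF (AT x) xT) (contraNF (BT x) xT).
have := TUD x xT; rewrite inE => /orP[/UAB//|/dominatedP[u uU xu]].
by rewrite (Ac x u) ?(Bc x u) ?UAB // UT.
Qed.

Lemma bicolorings_restrict T T' A : T \subset T' -> A \in bicolorings T' ->
  A :&: T \in bicolorings T.
Proof.
move=> /subsetP TT' /bicoloringsP[_ Ac]; apply/bicoloringsP; split; first exact: subsetIr.
move=> x y xT yT xy; rewrite !inE xT yT !andbT; apply: Ac => //; exact: TT'.
Qed.

(** Restriction to [T] is injective on [bicolorings T'], since colors on [U] force those of the
    dominated vertices, and its image misses [A]. *)
Lemma card_bicolorings_lt U T T' A : U \subset T -> T \subset T' ->
  T' \subset U :|: dominated U -> A \in bicolorings T ->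
  (forall B, B \in bicolorings T' -> B :&: T != A) ->
  #|bicolorings T'| < #|bicolorings T|.
Proof.
move=> UT TT' T'UD AT noB.
rewrite -(@card_in_imset _ _ (fun B => B :&: T)) => [|B C BT CT BC]; last first.
  apply: (bicolorings_eqI _ T'UD) => //; first exact: subset_trans TT'.
  by move=> u uU; move/setP: BC => /(_ u); rewrite !inE (subsetP UT u uU) !andbT.
apply: proper_card; apply/properP; split.
  by apply/subsetP => _ /imsetP[B BT ->]; apply: bicolorings_restrict BT.
by exists A => //; apply/imsetP => -[B BT AB]; move: (noB B BT); rewrite AB eqxx.
Qed.

Lemma bicolorings_sub0 T T' : T \subset T' -> bicolorings T = set0 -> bicolorings T' = set0.
Proof.
move=> TT' T0; apply/setP => B; rewrite in_set0.
by apply/negP => /(bicolorings_restrict TT'); rewrite T0 in_set0.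
Qed.

(* The trace on [U] of a bicoloring of [T] extends to a cut of [V(G)] by giving a
   dominated vertex the color opposite to its neighbours in [U]; every dominated
   edge inside a part of this cut rules out the bicoloring. *)
Lemma many_progress_pairs U T m : U \subset T -> T \subset U :|: dominated U ->
  bicolorings T != set0 -> 4 * m * #|~: dominated U| <= #|G| ->
  #|G| ^ 2 < m * gamma2 G ->
  #|G| ^ 2 <= 2 * m * #|[set p : G * G |
     #|bicolorings (T :|: ([set p.1; p.2] :&: dominated U))| < #|bicolorings T|]|.
Proof.
move=> UT TUD /set0Pn[A AT] few gam; set P := [set p | _].
pose X := [set x | [exists u in U, adj x u && (u \notin A)]].
set D := dominated U in few P *.
pose M := [set p : G * G | adj p.1 p.2 && ((p.1 \in X) == (p.2 \in X))].
have MP : M \subset P :|: (setX (~: D) setT :|: setX setT (~: D)).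
  apply/subsetP => -[x y]; rewrite !inE /= andbT => /andP[xy Xxy].
  case: (boolP (x \in D)) => xD; last by rewrite !inE in xD; rewrite xD orbT.
  case: (boolP (y \in D)) => yD; last by rewrite !inE in yD; rewrite yD !orbT.
  apply/orP; left; set T' := T :|: _.
  have xT' : x \in T' by rewrite /T' in_setU in_setI !in_set2 eqxx xD orbT.
  have yT' : y \in T' by rewrite /T' in_setU in_setI !in_set2 eqxx yD !orbT.
  have TT' : T \subset T' by apply: subsetUl.
  apply: (@card_bicolorings_lt U _ _ A) => //.
    apply/subsetP => z; rewrite /T' in_setU in_setI => /orP[/(subsetP TUD)//|/andP[_ zD]].
    by rewrite in_setU zD orbT.
  (* An extension [B] of [A] to [T'] would agree with [X] at [x] and [y], and so give both ends of
     an edge the same color. *)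
  move=> B /bicoloringsP[BT' Bc]; apply/eqP => BA.
  have BAu u : u \in U -> (u \in B) = (u \in A).
    by move=> uU; rewrite -BA inE (subsetP UT) // andbT.
  have BX z : z \in D -> z \in T' -> (z \in B) = (z \in X).
    move=> /dominatedP[u0 u0U zu0] zT'; rewrite [in RHS]inE.
    apply/idP/exists_inP => [zB|[u uU /andP[zu uA]]].
      exists u0 => //; rewrite zu0 -BAu //.
      by rewrite -(Bc z u0) // (subsetP TT') // (subsetP UT).
    by rewrite (Bc z u) // ?BAu // (subsetP TT') // (subsetP UT).
  have := Bc x y xT' yT' xy; rewrite !BX // !in_set (eqP Xxy).
  by case: [exists u in U, _].
have := leq_trans (subset_leq_card MP) (leq_card_setU _ _).1.
have := (leq_card_setU (setX (~: D) [set: G]) (setX [set: G] (~: D))).1.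
rewrite !cardsX cardsT => c1 c2; have c3 := gamma2_le X.
rewrite -/M in c3.
have {c1 c2 c3} c : gamma2 G <= #|P| + (#|~: D| * #|G| + #|G| * #|~: D|) by lia.
move: few gam c; rewrite -mulnn; set n := #|G|; set d := #|~: D|; set p := #|P|; set y := gamma2 G.
move=> few gam c.
(* Pairs with an undominated entry number at most [2 * d * n <= n ^ 2 / (2 * m)], half of the more
   than [n ^ 2 / m] pairs of [M] at most. *)
have few' : 4 * m * d * n <= n * n by rewrite leq_mul2r few orbT.
have : m * y <= m * (p + (d * n + n * d)) by rewrite leq_mul2l c orbT.
nia.
Qed.

(** Without odd closed walks, coloring each vertex by the parity of a walk from the root of its
    component is proper. *)
Lemma odd_closed_walk_of_no_bicoloring T :
  bicolorings T = set0 -> exists k, odd_closed_walk T k.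
Proof.
move=> T0; have [//|noodd] := pselect (exists k, odd_closed_walk T k); exfalso.
(* The predicate given to [pick] is the same for adjacent vertices, so one root serves a whole
   component. *)
pose root x := [pick y | `[< exists k, walk T k y x >]].
have root_adj x y : x \in T -> y \in T -> adj x y -> root x = root y.
  move=> xT yT xy; apply: eq_pick => z; apply/asboolP/asboolP => -[k w]; exists (k + 1).
    by apply: walk_cat w (walk1 _ _ _).
  by apply: walk_cat w (walk1 _ _ _) => //; rewrite adj_sym.
pose A := [set x in T | if root x is Some r then `[< exists2 k, odd k & walk T k r x >] else false].
suff: A \in bicolorings T by rewrite T0 inE.
apply/bicoloringsP; split; first by apply/subsetP => x; rewrite inE => /andP[].
have AP x y : x \in T -> y \in T -> adj x y -> x \in A -> y \notin A.
  move=> xT yT xy; rewrite !inE xT yT /= -(root_adj x y) //.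
  case: (root x) => // r /asboolP[j oj wj]; apply/negP => /asboolP[k ok wk].
  apply: noodd; exists (j + 1 + k); split; first by lia.
  by exists r; apply: walk_cat (walk_sym wk); apply: walk_cat wj (walk1 _ _ _).
have AN x y : x \in T -> y \in T -> adj x y -> x \notin A -> y \in A.
  move=> xT yT xy; rewrite !inE xT yT /= -(root_adj x y) //.
  rewrite /root; case: pickP => [r /asboolP[k w]|/(_ x)/negP[]]; last first.
    by apply/asboolP; exists 0; exact: walk0.
  move=> /asboolP no; apply/asboolP; exists (k + 1); last by apply: walk_cat w (walk1 _ _ _).
  by rewrite addn1 /=; apply/negP => ok; apply: no; exists k.
move=> x y xT yT xy; case: (boolP (x \in A)) => [/(AP x y xT yT xy)->//|].
by move=> /(AN x y xT yT xy)->.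
Qed.

End Colorings.

(** * Short odd closed walks in sets without 2-coloring *)

Section Roots.
Variables (G : sgraph) (g : nat).
Implicit Types (S T U W R : {set G}).

Definition linked W (r s : G) : bool := [exists w in W, adj r w && adj s w].

Definition linking U W : bool :=
  [forall R : {set G}, (R \subset U) && (#|R| == g.+1) ==>
     [exists r in R, exists s in R, (r != s) && linked W r s]].

Definition roots U W R : Prop :=
  [/\ R \subset U, #|R| <= g &
      {in U, forall u, exists2 r, r \in R & (u == r) || linked W u r}].

(** [R] is a maximal subset of [U] without linked pairs: [linking] bounds its size by [g], and
    maximality links every other vertex of [U] to it. *)
Lemma exists_roots U W : linking U W -> exists R, roots U W R.
Proof.
move=> /forallP lk.
pose P R := (R \subset U) && [forall r in R, forall s in R, (r != s) ==> ~~ linked W r s].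
have [|R /maxsetP[/andP[RU /forall_inP indep] maxR] _] := @maxset_exists _ P set0.
  by rewrite /P sub0set; apply/forall_inP => r; rewrite inE.
have indepR r s : r \in R -> s \in R -> r != s -> ~~ linked W r s.
  by move=> rR sR; move: (indep r rR) => /forall_inP/(_ s sR)/implyP.
exists R; split => //.
  rewrite leqNgt; apply/negP => /card_geqP[l [ul sl lR]].
  have := lk [set x in l]; rewrite cardsE (card_uniqP ul) sl eqxx andbT.
  have -> : [set x in l] \subset U.
    by apply: subset_trans RU; apply/subsetP => x; rewrite inE => /lR.
  move=> /existsP[r /andP[rl /existsP[s /andP[sl' /andP[rs]]]]].
  by apply/negP/indepR => //; apply: lR; [move: rl | move: sl']; rewrite inE.
move=> u uU; have [uR|uR] := boolP (u \in R); first by exists u; rewrite ?eqxx.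
have [/existsP[r /andP[rR ur]]|none] := boolP [exists r in R, linked W u r].
  by exists r => //; rewrite ur orbT.
have noneP r : r \in R -> ~~ linked W u r.
  by move=> rR; apply: contraNN none => ur; apply/existsP; exists r; rewrite rR.
have linkC r s : linked W r s = linked W s r.
  by apply: eq_existsb => w; rewrite [adj r w && _]andbC.
have := maxR (u |: R); rewrite subsetUr => /(_ _ isT) uRR; exfalso.
move/negP: uR; apply; rewrite -uRR ?setU11 // /P subUset sub1set uU RU /=.
apply/forall_inP => r rR; apply/forall_inP => s sR; apply/implyP.
move: rR sR; rewrite !in_setU1 => /predU1P[->|rR] /predU1P[->|sR].
- by rewrite eqxx.
- by rewrite noneP.
- by rewrite linkC noneP.
- exact: indepR.
Qed.

Lemma linked_dominated U W u r :
  u \in U -> linked W u r -> exists w, [/\ w \in W :&: dominated U, adj u w & adj r w].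
Proof.
move=> uU /existsP[w /and3P[wW uw rw]]; exists w; split => //.
by rewrite inE wW; apply/dominatedP; exists u => //; rewrite adj_sym.
Qed.

(** Linked vertices have equal colors, both opposite to that of their common neighbour. Hence the
    colors on [R] determine those on [U], which determine the rest. *)
Lemma card_bicolorings_roots U W R : roots U W R ->
  #|bicolorings (U :|: (W :&: dominated U))| <= 2 ^ g.
Proof.
move=> [RU Rg Rroot]; set T := U :|: _.
have UT : U \subset T := subsetUl _ _.
have TUD : T \subset U :|: dominated U by rewrite setUS // subsetIr.
have WT w : w \in W :&: dominated U -> w \in T by move=> h; rewrite inE h orbT.
apply: (@leq_trans (2 ^ #|R|)); last by rewrite leq_exp2l.
rewrite -card_powerset -(@card_in_imset _ _ (fun A => A :&: R) (mem (bicolorings T))).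
  by apply: subset_leq_card; apply/subsetP => B /imsetP[A _ ->]; rewrite inE subsetIr.
move=> A B AT BT AB; apply: (bicolorings_eqI UT TUD AT BT) => u uU.
have AB' r : r \in R -> (r \in A) = (r \in B).
  by move=> rR; move/setP: AB => /(_ r); rewrite !in_setI rR !andbT.
have [r rR /predU1P[->|]] := Rroot u uU; first exact: AB'.
have [rU uT] := (subsetP RU r rR, subsetP UT u uU).
have rT := subsetP UT r rU.
move/(linked_dominated uU) => [w [/WT wT uw rw]].
case/bicoloringsP: AT => _ Ac; case/bicoloringsP: BT => _ Bc.
rewrite (Ac u w) // (Bc u w) //; congr (~~ _).
by apply: negb_inj; rewrite -(Ac r w) // -(Bc r w) // AB'.
Qed.

Lemma walk_to_root U W R T t : roots U W R -> U :|: (W :&: dominated U) \subset T ->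
  T \subset U :|: dominated U -> t \in T ->
  exists2 r, r \in R & exists2 p, p <= 3 & walk T p t r.
Proof.
move=> [RU _ Rroot] /subsetP UWT /subsetP TUD tT.
have UT u : u \in U -> u \in T by move=> uU; apply: UWT; rewrite inE uU.
have fromU u : u \in U -> exists2 r, r \in R & exists2 p, p <= 2 & walk T p u r.
  move=> uU; have [r rR ur] := Rroot u uU; exists r => //.
  case/predU1P: ur => [->|/(linked_dominated uU)[w [wW uw rw]]].
    by exists 0 => //; apply: walk0; apply/UT/(subsetP RU).
  exists (1 + 1) => //.
  have wT : w \in T by apply: UWT; rewrite in_setU wW orbT.
  apply: (walk_cat (walk1 (UT u uU) wT uw)).
  by apply: walk1 => //; [apply/UT/(subsetP RU) | rewrite adj_sym].
have := TUD t tT; rewrite in_setU => /orP[/fromU[r rR [p p2 w]]|].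
  by exists r => //; exists p => //; lia.
move=> /dominatedP[u uU tu]; have [r rR [p p2 w]] := fromU u uU.
exists r => //; exists (1 + p); first by lia.
exact: walk_cat (walk1 tT (UT u uU) tu) w.
Qed.

(** On an odd closed walk of length at least [7 * g.+1], two of the [g.+1] positions [7 * i] reach
    the same root by walks of length at most 3. The resulting detour of length at most 6 is shorter
    than both arcs between these positions, so splitting there gives a shorter odd closed walk. *)
Lemma short_odd_closed_walk U W R T : roots U W R ->
  U :|: (W :&: dominated U) \subset T -> T \subset U :|: dominated U ->
  bicolorings T = set0 -> exists2 k, k < 7 * g.+1 & odd_closed_walk T k.
Proof.
move=> rR UWT TUD /odd_closed_walk_of_no_bicoloring[k].
elim/ltn_ind: k => k IH odc; case: (ltnP k (7 * g.+1)) => [kg|kg]; first by exists k.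
have [ok [x [t [t0 tk tw]]]] := odc.
have [h hP] : {h : 'I_g.+1 -> G &
    forall i, h i \in R /\ exists2 p, p <= 3 & walk T p (t (7 * i)) (h i)}.
  apply: (choice (P := fun i y => y \in R /\
    exists2 p, p <= 3 & walk T p (t (7 * nat_of_ord i)) y)) => i.
  have tT : t (7 * i) \in T by case: tw => tT _; apply: tT; have := ltn_ord i; lia.
  by have [r ? ?] := walk_to_root rR UWT TUD tT; exists r.
have [i [j [ij hij]]] : exists i j : 'I_g.+1, i < j /\ h i = h j.
  have [/injectiveP inj|/injectivePn[i [j ij hij]]] := boolP (injectiveb h).
    have : #|[set h i | i in 'I_g.+1]| <= #|R|.
      by apply: subset_leq_card; apply/subsetP => _ /imsetP[i _ ->]; case: (hP i).
    by rewrite card_imset // card_ord; case: rR; lia.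
  have : (i : nat) != j by [].
  by rewrite neq_ltn => /orP[]; [exists i, j | exists j, i].
have [_ [p p3 wp]] := hP i; have [_ [p' p3' wp']] := hP j.
rewrite hij in wp; have w := walk_cat wp (walk_sym wp').
have jg := ltn_ord j.
have ijk : 7 * i <= 7 * j <= k by lia.
have tkt : t k = t 0 by rewrite tk.
by case: (odd_closed_walk_split tw tkt ok ijk w) => c; apply: IH c; lia.
Qed.

End Roots.

(** * Random lists of vertices *)

(** With [t = m %/ k.+1], [bernoulli_exp] makes [(e / e.-1) ^ t] at least linear in [t]; its power
    [k.+1] outgrows [c * m ^ k]. *)
Lemma poly_expn_le c k e : 0 < e ->
  exists m0, forall m, m0 <= m -> c * m ^ k * e.-1 ^ m <= e ^ m.
Proof.
case: e => // -[|a] _ /=.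
  by exists 1 => -[//|m] _; rewrite exp0n // muln0.
set t0 := c * (2 * k.+1) ^ k * a.+1 ^ k.+1.
exists (k.+1 * t0.+1) => m mt.
pose t := m %/ k.+1.
have t0t : t0 < t by rewrite /t leq_divRL // mulnC.
have mt2 : m <= 2 * k.+1 * t.
  have := divn_eq m k.+1; have := ltn_pmod m (isT : 0 < k.+1); rewrite -/t; nia.
have bern : t * a.+1 ^ t <= a.+1 * a.+2 ^ t.
  case: {t0t mt2} t => // t; rewrite [a.+1 ^ _]expnS mulnCA leq_mul2l /=.
  by apply: leq_trans (bernoulli_exp _ _); apply: leq_addr.
rewrite -(@leq_pmul2l (a.+1 ^ k.+1)) ?expn_gt0 //.
apply: (@leq_trans (t ^ k.+1 * a.+1 ^ m)).
  rewrite mulnA leq_mul2r; apply/orP; right; rewrite [t ^ _]expnSr.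
  apply: (@leq_trans (a.+1 ^ k.+1 * (c * (2 * k.+1 * t) ^ k))).
    rewrite !leq_mul2l; case: (k) mt2 => [|k'] mt2; first by rewrite !orbT.
    by rewrite leq_exp2r // mt2 !orbT.
  rewrite expnMn; apply: (@leq_trans (t ^ k * t0)); first by rewrite /t0; nia.
  by rewrite leq_mul2l (ltnW t0t) orbT.
rewrite (divn_eq m k.+1) -/t !expnD !expnM mulnA [leqRHS]mulnA -!expnMn.
by apply: leq_mul; [rewrite leq_exp2r | case: (m %% _) => // s; rewrite leq_exp2r].
Qed.

Section Count.
Variables (G : sgraph) (g e m : nat).
Hypothesis e_gt0 : 0 < e.
Hypothesis min_degree : forall x : G, (2 * e + (2 * g + 1)) * #|G| <= (2 * g + 1) * e * deg x.
Local Notation n := #|G|.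

Definition dominating (u : seq G) : bool := 4 * m * #|~: dominated [set x in u]| <= n.

(** Markov's inequality: the expected number of undominated vertices is at most
    [n * (1 - 1 / e) ^ m], far below the threshold [n / (4 * m)]. *)
Lemma sum_not_dominating : 0 < n -> 16 * m * e.-1 ^ m <= e ^ m ->
  4 * \sum_(u <- words G m) ~~ dominating u <= n ^ m.
Proof.
move=> n0 me.
have h : e ^ m * \sum_(u <- words G m) #|~: dominated [set x in u]| <= n * (e.-1 * n) ^ m.
  rewrite (eq_bigr (fun u => \sum_(x : G) all (fun v => v \notin [set y | adj x y]) u)).
    rewrite exchange_big /= big_distrr /= -sum_nat_const; apply: leq_sum => x _.
    by apply: sum_avoid; apply: (linear_degree min_degree x).
  move=> u _; rewrite -sum1_card big_mkcond; apply: eq_bigr => x _.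
  rewrite (_ : (x \in _) = all (fun v => v \notin [set y | adj x y]) u); first by case: all.
  rewrite in_setC inE; apply/negP/allP => [nd v vu|av /exists_inP[v]].
    by rewrite inE; apply/negP => xv; apply: nd; apply/exists_inP; exists v; rewrite ?inE.
  by rewrite inE => /av; rewrite inE => /negP.
have h2 : n * \sum_(u <- words G m) ~~ dominating u <=
   4 * m * \sum_(u <- words G m) #|~: dominated [set x in u]|.
  rewrite !big_distrr; apply: leq_sum => u _; rewrite /dominating.
  by case: (leqP (4 * m * _) n) => [_|/ltnW] /=; rewrite ?muln1 ?muln0.
have em : 0 < e ^ m by rewrite expn_gt0 e_gt0.
rewrite -(@leq_pmul2l (e ^ m * n)) ?muln_gt0 ?em //.
move: h h2; rewrite expnMn; set S1 := \sum_(u <- _) _; set S2 := \sum_(u <- _) _ => h h2.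
apply: (@leq_trans (16 * m * e.-1 ^ m * (n * n ^ m))); last first.
  by rewrite -[leqRHS]mulnA leq_mul2r me orbT.
have : e ^ m * (n * S2) <= e ^ m * (4 * m * S1) by rewrite leq_mul2l h2 orbT.
have : 4 * m * (e ^ m * S1) <= 4 * m * (n * (e.-1 ^ m * n ^ m)) by rewrite leq_mul2l h orbT.
nia.
Qed.

(** Union bound over the at most [m ^ g.+1] sets [R]: each has at least [n / e] vertices adjacent to
    two of its members, and the random list must miss all of them. *)
Lemma sum_not_linking (U : {set G}) : #|U| <= m ->
  4 * m ^ g.+1 * e.-1 ^ m <= e ^ m ->
  4 * \sum_(w <- words G m) ~~ linking g U [set x in w] <= n ^ m.
Proof.
move=> Um me; pose C (R : {set G}) : {set G} :=
  [set v | 1 < #|[set i : {x : G | x \in R} | adj (val i) v]|].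
have h : \sum_(w <- words G m) ~~ linking g U [set x in w] <=
   \sum_(R : {set G} | (R \subset U) && (#|R| == g.+1))
      \sum_(w <- words G m) all (fun v => v \notin C R) w.
  rewrite exchange_big; apply: leq_sum => w _ /=.
  have [//|/forallPn[R]] := boolP (linking g U [set x in w]).
  rewrite negb_imply => /andP[RU /exists_inPn lR].
  rewrite (bigD1 R) //= (_ : all _ _) //; apply/allP => v vw.
  rewrite inE -leqNgt leqNgt; apply/card_gt1P => -[[r rR] [[s sR]]] [].
  rewrite !inE /= => rv sv rs; have /exists_inPn/(_ s sR) := lR r rR.
  rewrite negb_and negbK => /orP[/eqP eqrs|/exists_inPn/(_ v)].
    by move/eqP: rs; apply; apply: val_inj.
  by rewrite inE rv sv => /(_ vw).
have {}h : e ^ m * \sum_(w <- words G m) ~~ linking g U [set x in w] <=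
           m ^ g.+1 * (e.-1 * n) ^ m.
  apply: leq_trans (leq_mul (leqnn _) h) _; rewrite big_distrr /=.
  apply: (@leq_trans (\sum_(R : {set G} | (R \subset U) && (#|R| == g.+1)) (e.-1 * n) ^ m)).
    apply: leq_sum => R /andP[_ /eqP cR]; apply: sum_avoid.
    apply: (@many_common_neighbours G g e min_degree {x : G | x \in R} val 1).
      by rewrite card_sig cR.
    by rewrite card_sig cR; lia.
  rewrite sum_nat_cond_const leq_mul2r; apply/orP; right.
  rewrite (eq_card (B := [set R : {set G} | (R \subset U) && (#|R| == g.+1)])); last first.
    by move=> R; rewrite inE.
  rewrite cards_draws; apply: (@leq_trans (#|U| ^ g.+1)); last by rewrite leq_exp2r.
  apply: leq_trans (leq_pmulr _ (fact_gt0 g.+1)) _; rewrite bin_ffact.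
  elim: (g.+1) (#|U|) => // k IH a; rewrite ffactnS expnS leq_mul2l; apply/orP; right.
  apply: leq_trans (IH _) _; case: k {IH} => // k; rewrite leq_exp2r //; lia.
have em : 0 < e ^ m by rewrite expn_gt0 e_gt0.
rewrite -(@leq_pmul2l (e ^ m)) //.
move: h; rewrite expnMn; set S1 := \sum_(w <- _) _ => h.
apply: (@leq_trans (4 * m ^ g.+1 * e.-1 ^ m * n ^ m)); first by nia.
by rewrite leq_mul2r me orbT.
Qed.

Definition short_odd k (s : seq G) : bool :=
  `[< exists2 k', k' <= k & odd_closed_walk [set x in s] k' >].

Lemma short_odd_cat k s t : short_odd k s -> short_odd k (t ++ s).
Proof.
move=> /asboolP[k' k'k w]; apply/asboolP; exists k' => //.
by apply: odd_closed_walkS w; apply/subsetP => x; rewrite !inE mem_cat orbC => ->.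
Qed.

(** Each new vertex shortens a too long odd closed walk by 2 with probability at least [1 / e]. *)
Lemma sum_short_odd q s : 2 <= g -> short_odd (2 * g - 1 + 2 * q) s ->
  n ^ q <= e ^ q * \sum_(t <- words G q) short_odd (2 * g - 1) (t ++ s).
Proof.
move=> g2; elim: q s => [|q IH] s.
  by rewrite muln0 addn0 => h; rewrite big_seq1 /= h.
move=> h; rewrite -addn1 sum_words_cat sum_wordsS big_seq1 addn1 /=.
pose B := [set v | short_odd (2 * g - 1 + 2 * q) (v :: s)].
have nB : n <= e * #|B|.
  move/asboolP: h => [k kq odk]; case: (leqP k (2 * g - 1 + 2 * q)) => kq'.
    rewrite (_ : B = setT) ?cardsT; first by rewrite leq_pmull.
    apply/setP => v; rewrite !inE; apply: (@short_odd_cat _ s [:: v]).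
    by apply/asboolP; exists k.
  (* By parity [k = 2 * g + 1 + 2 * q] here, just long enough for at least [n / e] vertices to see
     three positions. *)
  have [ok [x [t [t0 tk tw]]]] := odk.
  apply: leq_trans (@many_common_neighbours G g e min_degree 'I_k (fun i => t i) 2 _ _) _.
  - by rewrite card_ord; lia.
  - by rewrite card_ord; lia.
  rewrite leq_mul2l; apply/orP; right; apply: subset_leq_card; apply/subsetP => v.
  rewrite !inE => c3; apply/asboolP.
  have [a [b [c [[av bv cv] [abc ck]]]]] : exists a b c,
      [/\ adj (t a) v, adj (t b) v & adj (t c) v] /\ (a < b < c /\ c < k).
    have [l [ul sl lP]] := card_geqP c3.
    have {lP} lP' i : i \in map val l -> i < k /\ adj (t i) v.
      by move=> /mapP[j /lP]; rewrite inE => ja ->; split; [exact: ltn_ord|].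
    have : uniq (map (val : 'I_k -> nat) l) by rewrite map_inj_uniq //; exact: val_inj.
    case: l sl lP' {ul} => [//|a [//|b [//|c [|//]]]] _ lP' /=.
    have [ak av] := lP' a (mem_head _ _).
    have [bk bv] : b < k /\ adj (t b) v by apply: lP'; rewrite /= !inE eqxx orbT.
    have [ck cv] : c < k /\ adj (t c) v by apply: lP'; rewrite /= !inE eqxx !orbT.
    rewrite !inE negb_or andbT => /andP[/andP[ab ac] bc].
    have [] : a < b < c \/ a < c < b \/ b < a < c \/ b < c < a \/ c < a < b \/ c < b < a by lia.
      by move=> abc; exists a, b, c.
    case=> [acb|]; first by exists a, c, b.
    case=> [bac|]; first by exists b, a, c.
    case=> [bca|]; first by exists b, c, a.
    by case=> [cab|cba]; [exists c, a, b | exists c, b, a].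
  have tw' : is_walk [set x in v :: s] k t.
    by case: tw => tS ta; split => // i /tS; rewrite !inE => ->; rewrite orbT.
  have tkt : t k = t 0 by rewrite tk.
  have vS : v \in [set x in v :: s] by rewrite inE mem_head.
  have k5 : 5 <= k by lia.
  have [k' k'k w] := odd_closed_walk_shorten k5 tw' tkt ok abc ck vS av bv cv.
  by exists k' => //; lia.
apply: (@leq_trans (e * #|B| * n ^ q)); first by rewrite expnS leq_mul2r nB orbT.
rewrite [e ^ q.+1]expnS -!mulnA leq_mul2l; apply/orP; right.
rewrite -sum_nat_const big_mkcond big_distrr /=; apply: leq_sum => v _.
case: ifP => //; rewrite inE => /IH le; apply: leq_trans le _.
by rewrite leq_mul2l; apply/orP; right; apply: leq_sum => t _; rewrite -catA.
Qed.

End Count.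

(** * Counting short odd cycles *)

Lemma far_gt0 (G : sgraph) m : #|G| ^ 2 < m * gamma2 G -> 0 < #|G|.
Proof.
apply: contraTT; rewrite -eqn0Ngt -leqNgt => /eqP n0.
have := gamma2_le (set0 : {set G}); set A := [set p | _].
have := max_card (mem A); rewrite card_prod n0 => A0 /leq_trans/(_ A0).
by rewrite leqn0 => /eqP->; rewrite muln0.
Qed.

Section Main.
Variables (G : sgraph) (g e m : nat).
Hypothesis e_gt0 : 0 < e.
Hypothesis min_degree : forall x : G, (2 * e + (2 * g + 1)) * #|G| <= (2 * g + 1) * e * deg x.
Hypothesis far : #|G| ^ 2 < m * gamma2 G.
Local Notation n := #|G|.

(* The undominated entries of [s] are left out, so that a bicoloring of the core is
   determined by its trace on [u]. *)
Definition core (u s : seq G) : {set G} :=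
  [set x in u] :|: ([set x in s] :&: dominated [set x in u]).

Lemma core_sub u s : core u s \subset [set x in u] :|: dominated [set x in u].
Proof. by rewrite setUS // subsetIr. Qed.

Lemma core_cat u s t : core u (t ++ s) =
  core u s :|: ([set x in t] :&: dominated [set x in u]).
Proof.
apply/setP => x; rewrite !in_setU !in_setI !in_set mem_cat.
by case: (x \in u); case: (x \in s); case: (x \in t); rewrite ?orbF ?orbb ?orbT.
Qed.

(** Induction on the bound [r]: by [many_progress_pairs] a random pair lowers the number of
    bicolorings with probability at least [1 / (2 * m)], and once it is 0 it stays 0. *)
Lemma sum_no_bicoloring u s r : dominating m u -> #|bicolorings (core u s)| <= r ->
  n ^ (2 * r) <=
  (2 * m) ^ r * \sum_(t <- words G (2 * r)) (bicolorings (core u (t ++ s)) == set0).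
Proof.
move=> du; have m0 : 0 < m by case: m far.
elim: r s => [|r IH] s.
  by rewrite leqn0 cards_eq0 => /eqP c0; rewrite big_seq1 /= c0 eqxx.
have [c0 _|c0 cr] := eqVneq (bicolorings (core u s)) set0.
  rewrite (eq_bigr (fun _ => 1)).
    by rewrite sum_words_const muln1 leq_pmull // expn_gt0 muln_gt0 m0.
  by move=> t _; rewrite core_cat (bicolorings_sub0 (subsetUl _ _) c0) eqxx.
rewrite mulnS addnC sum_words_cat sum_wordsS.
rewrite sum_wordsS big_seq1 pair_bigA /=.
have UT : [set x in u] \subset core u s by apply: subsetUl.
have := many_progress_pairs UT (core_sub u s) c0 du far.
move=> nP.
rewrite expnD mulnC; apply: leq_trans (leq_mul nP (leqnn _)) _.
rewrite expnS -!mulnA !leq_mul2l; apply/orP; right; apply/orP; right.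
rewrite -sum_nat_const big_mkcond big_distrr /=; apply: leq_sum => -[y x] _.
case: ifP => //; rewrite inE /= => lt.
apply: leq_trans (IH [:: x, y & s] _) _; last first.
  by rewrite leq_mul2l; apply/orP; right; apply: leq_sum => t _; rewrite -catA.
have -> : core u [:: x, y & s] = core u s :|: ([set y; x] :&: dominated [set x in u]).
  rewrite -[[:: x, y & s]]/([:: x; y] ++ s) core_cat; congr (_ :|: (_ :&: _)).
  by apply/setP => z; rewrite !inE orbC.
by rewrite -ltnS; apply: leq_trans lt cr.
Qed.

(** The roots leave at most [2 ^ g] bicolorings, so [2 ^ g] random pairs [z] can remove them all.
    The odd closed walk that then exists is shorter than [7 * g.+1], and the [q] vertices of [t]
    bring it down to [2 * g - 1]. *)
Lemma sum_after_linking q u w : 2 <= g -> 7 * g.+1 <= 2 * g + 2 * q ->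
  dominating m u -> linking g [set x in u] [set x in w] ->
  n ^ (2 * 2 ^ g + q) <= (2 * m) ^ (2 ^ g) * e ^ q *
    \sum_(z <- words G (2 * 2 ^ g)) \sum_(t <- words G q)
       short_odd (2 * g - 1) (t ++ z ++ w ++ u).
Proof.
move=> g2 qg du /exists_roots[R Rroot].
have := sum_no_bicoloring du (card_bicolorings_roots Rroot); rewrite -/(core u w) => lo.
rewrite expnD mulnC; apply: leq_trans (leq_mul (leqnn _) lo) _.
rewrite mulnCA -mulnA leq_mul2l; apply/orP; right.
rewrite !big_distrr; apply: leq_sum => z _ /=.
case: eqP => [c0|]; last by rewrite muln0.
rewrite muln1; apply: sum_short_odd => //; apply/asboolP.
have UWT : [set x in u] :|: ([set x in w] :&: dominated [set x in u]) \subset core u (z ++ w).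
  by rewrite core_cat; apply: subsetUl.
have [k kg odk] := short_odd_closed_walk Rroot UWT (core_sub _ _) c0.
exists k; first by lia.
apply: odd_closed_walkS odk; apply/subsetP => x; rewrite !inE !mem_cat.
by case: (x \in u); case: (x \in w); case: (x \in z).
Qed.

(** The lists [u], [w], [z], [t] are exposed in this order; [u] dominates and [w] links with
    probability at least 1/2 each, whence the factor 4. *)
Lemma sum_short_odd_ge q : 2 <= g -> 7 * g.+1 <= 2 * g + 2 * q ->
  16 * m * e.-1 ^ m <= e ^ m -> 4 * m ^ g.+1 * e.-1 ^ m <= e ^ m ->
  n ^ (q + (2 * 2 ^ g + (m + m))) <= 4 * (2 * m) ^ (2 ^ g) * e ^ q *
    \sum_(t <- words G (q + (2 * 2 ^ g + (m + m)))) short_odd (2 * g - 1) t.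
Proof.
move=> g2 qg me1 me2; rewrite !sum_words_cat.
have n0 := far_gt0 far.
set c := (2 * m) ^ (2 ^ g) * e ^ q; set N := n ^ (2 * 2 ^ g + q).
have linkS u : u \in words G m -> dominating m u ->
   N * n ^ m <= 2 * c * \sum_(w <- words G m) \sum_(z <- words G (2 * 2 ^ g))
     \sum_(t <- words G q) short_odd (2 * g - 1) (t ++ z ++ w ++ u).
  rewrite mem_words => /eqP su du.
  have um : #|[set x in u]| <= m by rewrite cardsE -su; apply: card_size.
  have lk := sum_words_half (sum_not_linking e_gt0 min_degree um me2).
  apply: (@leq_trans (2 * \sum_(w <- words G m) N * linking g [set x in u] [set x in w])).
    by rewrite -big_distrr /= mulnCA leq_mul2l lk orbT.
  rewrite -mulnA leq_mul2l /= big_distrr; apply: leq_sum => w _.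
  case: (boolP (linking _ _ _)) => [lk'|]; last by rewrite muln0.
  by rewrite muln1; apply: sum_after_linking.
have dom := sum_words_half (sum_not_dominating e_gt0 min_degree n0 me1).
have -> : n ^ (q + (2 * 2 ^ g + (m + m))) = N * n ^ m * n ^ m.
  by rewrite /N -!expnD; congr (_ ^ _); lia.
apply: (@leq_trans (2 * \sum_(u <- words G m) N * n ^ m * dominating m u)).
  by rewrite -big_distrr /= mulnCA leq_mul2l dom orbT.
have -> : 4 * (2 * m) ^ (2 ^ g) * e ^ q = 2 * (2 * c) by rewrite /c; lia.
rewrite -mulnA leq_mul2l /= big_distrr big_seq [leqRHS]big_seq.
apply: leq_sum => u uw.
case: (boolP (dominating m u)) => [du|]; last by rewrite muln0.
by rewrite muln1; apply: leq_trans (linkS u uw du) _.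
Qed.

End Main.

Section OddCycles.
Variables (G : sgraph) (g : nat).
Local Notation n := #|G|.

(** Length 1 is excluded, as [closed_seq] would demand a loop; these are the odd cycles with a
    starting point and a direction. *)
Definition odd_cycle_seq (c : seq G) : bool := [&& odd (size c), uniq c & `[< closed_seq c >]].

Lemma short_odd_cycle k s : short_odd k s ->
  exists c : seq G, [/\ size c <= k, odd_cycle_seq c & all (mem s) c].
Proof.
move=> /asboolP[k1 k1k /odd_closed_walk_inj[k2 [t [k21 ok2 [tS ta] tk inj]]]].
exists (mkseq t k2); rewrite size_mkseq; split; first exact: leq_trans k1k.
  rewrite /odd_cycle_seq size_mkseq ok2 andTb; apply/andP; split.
    apply/(mkseq_uniqP t k2) => i j; rewrite !inE => ik jk tij.
    case: (ltngtP i j) => // ij.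
      by have := inj i j; rewrite ij jk tij eqxx => /(_ isT).
    by have := inj j i; rewrite ij ik tij eqxx => /(_ isT).
  apply/asboolP => d i; rewrite size_mkseq => ik.
  rewrite nth_mkseq // nth_mkseq ?ltn_pmod //; last by lia.
  have [ik'|ik'] := eqVneq i.+1 k2; first by rewrite ik' modnn -tk -ik'; apply: ta.
  by rewrite modn_small; [exact: ta | lia].
apply/allP => x /mapP[i]; rewrite mem_iota => ik ->.
by have := tS i; rewrite inE; apply; lia.
Qed.

(** First moment bound: by [sum_words_sub] a fixed cycle of length [l] lies in a random list with
    probability at most [(M / n) ^ l], and there are at most [n ^ l / B] such cycles. *)
Lemma sum_short_odd_le M B : 0 < M ->
  (forall l, l < 2 * g -> B * \sum_(c <- words G l) odd_cycle_seq c <= n ^ l) -> 0 < n ->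
  B * \sum_(t <- words G M) short_odd (2 * g - 1) t <= 2 * g * (M ^ (2 * g) * n ^ M).
Proof.
move=> M0 few n0.
have h t : t \in words G M -> short_odd (2 * g - 1) t <=
    \sum_(l < 2 * g) \sum_(c <- words G l | odd_cycle_seq c) all (mem t) c.
  move=> tM; have [/short_odd_cycle[c [cg oc ct]]|//] := boolP (short_odd _ t).
  have lc : size c < 2 * g by case: c cg oc ct => // x c /= cg oc ct; lia.
  rewrite (bigD1 (Ordinal lc)) //= (big_rem c) ?mem_words //= oc ct //.
apply: (@leq_trans (\sum_(l < 2 * g)
    B * \sum_(c <- words G l | odd_cycle_seq c) \sum_(t <- words G M) all (mem t) c)).
  rewrite -big_distrr /= leq_mul2l; apply/orP; right.
  under [leqRHS]eq_bigr do rewrite exchange_big /=.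
  rewrite exchange_big /= big_seq [leqRHS]big_seq; exact: leq_sum.
have -> : 2 * g * (M ^ (2 * g) * n ^ M) = \sum_(l < 2 * g) M ^ (2 * g) * n ^ M.
  by rewrite sum_nat_const card_ord.
apply: leq_sum => l _.
have nl : 0 < n ^ l by rewrite expn_gt0 n0.
rewrite -(@leq_pmul2l (n ^ l)) //.
apply: (@leq_trans (B * \sum_(c <- words G l) odd_cycle_seq c * (M ^ l * n ^ M))).
  rewrite mulnCA leq_mul2l; apply/orP; right; rewrite big_distrr [leqLHS]big_mkcond.
  rewrite big_seq [leqRHS]big_seq; apply: leq_sum => c; rewrite mem_words => /eqP sc.
  case: (boolP (odd_cycle_seq c)) => // /and3P[_ uc _]; rewrite mul1n -sc.
  exact: sum_words_sub.
rewrite -big_distrl /= [leqLHS]mulnA.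
apply: leq_mul; first exact: few.
by rewrite leq_mul2r; apply/orP; right; rewrite leq_pexp2l // ltnW.
Qed.

End OddCycles.

(** A random list of length linear in [m] contains a short odd cycle with probability of order at
    least [m ^ -(2 ^ g)]. Were the cycles of each length at most [n ^ l / m ^ q] in number, the
    first moment would bound this by order [m ^ (2 * g - q)], a contradiction for
    [q = 2 ^ g + 2 * g + 1] and large [m]. *)
Lemma many_odd_cycles g e : 2 <= g -> 0 < e -> exists q m0, forall (G : sgraph) m,
  (forall x : G, (2 * e + (2 * g + 1)) * #|G| <= (2 * g + 1) * e * deg x) ->
  m0 <= m -> #|G| ^ 2 < m * gamma2 G ->
  exists2 l, l < 2 * g & #|G| ^ l < m ^ q * \sum_(c <- words G l) odd_cycle_seq c.
Proof.
move=> g2 e0; pose q := 7 * g.+1; pose a := q + 2 * 2 ^ g.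
have [m1 M1] := poly_expn_le 16 1 e0; have [m2 M2] := poly_expn_le 4 g.+1 e0.
pose c := 4 * 2 ^ (2 ^ g) * e ^ q * (2 * g * (a + 2) ^ (2 * g)).
exists (2 ^ g + 2 * g).+1, (maxn (maxn m1 m2) c.+1) => G m md.
rewrite !geq_max => /andP[/andP[/M1 me1 /M2 me2] cm] far; rewrite expn1 in me1.
have m0 : 0 < m by apply: leq_trans cm.
apply/not_exists2P => few.
have n0 := far_gt0 far.
have few' l : l < 2 * g ->
  m ^ (2 ^ g + 2 * g).+1 * \sum_(c <- words G l) odd_cycle_seq c <= #|G| ^ l.
  by move=> lg; case: (few l) => // /negP; rewrite -leqNgt.
have qg : 7 * g.+1 <= 2 * g + 2 * q by rewrite /q; lia.
have lo := sum_short_odd_ge e0 md far g2 qg me1 me2.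
move: lo; set M := q + _ => lo.
have M0 : 0 < M by rewrite /M /q; lia.
have hi := sum_short_odd_le M0 few' n0.
have Ma : M <= (a + 2) * m by rewrite /M /a; nia.
set S := \sum_(t <- _) _ in lo hi.
have nM : 0 < #|G| ^ M by rewrite expn_gt0 n0.
have: m ^ (2 ^ g + 2 * g).+1 * #|G| ^ M <= c * m ^ (2 ^ g + 2 * g) * #|G| ^ M.
  apply: leq_trans (leq_mul (leqnn _) lo) _; rewrite mulnCA.
  apply: leq_trans (leq_mul (leqnn _) hi) _.
  have MM : M ^ (2 * g) <= (a + 2) ^ (2 * g) * m ^ (2 * g).
    by rewrite -expnMn leq_exp2r //; lia.
  rewrite expnMn expnD /c; move: MM; set X := M ^ _; set Y := (a + 2) ^ _.
  set m' := m ^ (2 * g); set m'' := m ^ (2 ^ g); set N := #|G| ^ M => MM.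
  have := leq_mul (leqnn (4 * 2 ^ 2 ^ g * m'' * e ^ q * (2 * g) * N)) MM; lia.
rewrite leq_pmul2r // expnS leq_pmul2r ?expn_gt0 ?m0 //.
by rewrite leqNgt cm.
Qed.

(** * Conclusion *)

(** The cycle length depends on [G], whereas [Q] and [m0] must be fixed before it; hence maxima over
    all [l < b]. *)
Lemma kst_uniform b h q : exists Q m0, forall l, l < b ->
  forall (V : finType) (A : pred (seq V)) m,
  m0 <= m -> m ^ Q <= #|V| ->
  #|V| ^ l <= m ^ q * \sum_(t <- words V l) A t ->
  exists S : seq (seq V), [/\ size S = l,
    {in S, forall s, uniq s && (size s == h)} &
    forall x, all2 (fun v s => v \in s) x S -> A x].
Proof.
elim: b => [|b [Q1 [m1 H1]]]; first by exists 0, 0.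
have [Q2 [m2 H2]] := kst b h q.
exists (maxn Q1 Q2), (maxn 1 (maxn m1 m2)) => l lb V A m.
rewrite !geq_max => /and3P[m_gt0 mm1 mm2] mV dense.
move: lb; rewrite ltnS leq_eqVlt => /predU1P[lb|lb].
  rewrite lb in dense *; apply: H2 mm2 _ dense.
  by apply: leq_trans mV; rewrite leq_pexp2l // leq_maxr.
apply: (H1 l lb _ _ m mm1) dense.
by apply: leq_trans mV; rewrite leq_pexp2l // leq_maxl.
Qed.

Lemma has_hom_triangle (H : sgraph) : chromatic_number H = 3 -> has_hom H (cycle_graph 3).
Proof.
rewrite /chromatic_number; case: ex_minnP => k /existsP[c /forallP col] _ k3; subst k.
exists c => x y xy; have := col x => /forallP/(_ y)/implyP/(_ xy).
by rewrite /= /cycle_adj; case: (c x) => [[|[|[|]]] ?] //; case: (c y) => [[|[|[|]]] ?].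
Qed.

Lemma gamma2_small (H : sgraph) g e : chromatic_number H = 3 -> 2 <= g ->
  (forall k, 2 <= k -> ~ has_hom H (cycle_graph (2 * k + 1)) -> g <= k) -> 0 < e ->
  exists Q m0, forall (G : sgraph) m,
    (forall x : G, (2 * e + (2 * g + 1)) * #|G| <= (2 * g + 1) * e * deg x) ->
    is_free H G -> m0 <= m -> m ^ Q <= #|G| -> m * gamma2 G <= #|G| ^ 2.
Proof.
move=> chiH g2 g_min e0; have [q [m1 cyc]] := many_odd_cycles g2 e0.
have [Q [m2 blow]] := kst_uniform (2 * g) #|H| q.
exists Q, (maxn m1 m2) => G m md free; rewrite geq_max => /andP[mm1 mm2] mQ.
rewrite leqNgt; apply/negP => far; apply: free.
have [l lg dense] := cyc G m md mm1 far.
have [S [sS hS AS]] := blow l lg G (@odd_cycle_seq G) m mm2 mQ (ltnW dense).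
have ocl : exists2 c : seq G, size c = l & odd_cycle_seq c.
  apply: contrapT => none; move: dense; rewrite big_seq big1 ?muln0 // => c.
  rewrite mem_words => /eqP sc; case: (boolP (odd_cycle_seq c)) => // oc.
  by case: none; exists c.
(* The density is positive, so an odd cycle of length [l] exists; thus [l] is odd and at least 3. *)
have [k lk k0] : exists2 k, l = 2 * k + 1 & 0 < k.
  case: ocl => c sc /and3P[ol _ /asboolP cc]; rewrite sc in ol.
  exists l./2; first by lia.
  rewrite lt0n; apply/negP => /eqP l0; have l1 : l = 1 by lia.
  case: c sc cc; rewrite l1 // => x [] // _ /(_ x 0 isT); by rewrite /= adj_irr.
(* Here [k < g]: minimality of [g] applies for [k >= 2], and a 3-coloring is the homomorphism for
   [k = 1]. *)
have [f homf] : has_hom H (cycle_graph l).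
  rewrite lk; case: (ltngtP k 1) => [|k2|->]; first by lia.
    by apply: contrapT => /(g_min k k2); lia.
  exact: has_hom_triangle.
by apply: (box_subgraph homf sS hS) => x /AS/and3P[_ ux /asboolP].
Qed.

Import Order.TTheory GRing.Theory Num.Theory.
Local Open Scope ring_scope.

Theorem theorem1p2 (R : realType) (H : sgraph) (g : nat)
    (chiH : chromatic_number H = 3%N)
    (g_ge2 : (2 <= g)%N)
    (g_nohom : ~ has_hom H (cycle_graph (2 * g + 1)))
    (g_min : forall k : nat, (2 <= k)%N ->
       ~ has_hom H (cycle_graph (2 * k + 1)) -> (g <= k)%N)
    (eps : R) (eps_gt0 : 0 < eps) :
  exists (C rho : R) (n0 : nat), 0 < C /\ 0 < rho /\
    forall G : sgraph, is_free H G -> (n0 <= #|G|)%N ->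
      (2%:R / (2 * g + 1)%:R + eps) * #|G|%:R <= (min_deg G)%:R ->
      (gamma2 G)%:R <= C * (#|G|%:R `^ (2%:R - rho)).
Proof.
have [e e0 e_eps] : exists2 e, (0 < e)%N & e%:R^-1 <= eps.
  exists (Num.truncn eps^-1).+1 => //.
  rewrite -[leRHS]invrK lef_pV2 ?posrE ?ltr0n ?invr_gt0 //.
  exact: ltW (truncnS_gt _).
have [Q0 [m0 small0]] := gamma2_small chiH g_ge2 g_min e0.
(* [Q] has to be invertible, and a positive [m] gives [m ^ Q0 <= m ^ Q]. *)
pose Q := Q0.+1; pose m1 := maxn 1 m0.
have small (G : sgraph) m :
    (forall x : G, (2 * e + (2 * g + 1)) * #|G| <= (2 * g + 1) * e * deg x)%N ->
    is_free H G -> (m1 <= m)%N -> (m ^ Q <= #|G|)%N -> (m * gamma2 G <= #|G| ^ 2)%N.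
  move=> md free; rewrite geq_max => /andP[mpos mm0] mQ; apply: small0 => //.
  by apply: leq_trans mQ; rewrite leq_pexp2l.
(* The factor 2 pays for rounding [n ^ (1 / Q)] down to an integer [m]; the choice of [n0] ensures
   [m1 <= m]. *)
exists 2, Q%:R^-1, (m1 ^ Q)%N; split; first by []; split; first by rewrite invr_gt0 ltr0n.
move=> G free nG degG.
have md (x : G) : ((2 * e + (2 * g + 1)) * #|G| <= (2 * g + 1) * e * deg x)%N.
  have le1 : (2%:R / (2 * g + 1)%:R + e%:R^-1) * #|G|%:R <= (deg x)%:R :> R.
    apply: le_trans (_ : (min_deg G)%:R <= _); last by rewrite ler_nat min_deg_le.
    by apply: le_trans degG; rewrite ler_wpM2r ?ler0n // lerD2l.
  rewrite -(ler_nat R) !natrM.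
  have c0 : 0 < (2 * g + 1)%:R * e%:R :> R by rewrite -natrM ltr0n muln_gt0 addn1 e0.
  apply: le_trans (ler_wpM2l (ltW c0) le1); rewrite mulrA le_eqVlt; apply/orP; left; apply/eqP.
  congr (_ * _); rewrite natrD natrM; field.
  by rewrite -natrM natr1 !pnatr_eq0 -lt0n e0.
have exm : exists m, (m ^ Q <= #|G|)%N by exists m1.
have bound m : (m ^ Q <= #|G| -> m <= #|G|)%N.
  by apply: leq_trans; case: m => // m; rewrite -{1}[m.+1]expn1 leq_pexp2l.
case: (ex_maxnP exm bound) => m mQ mmax.
have m1m : (m1 <= m)%N by apply: mmax.
have m_gt0 : (0 < m)%N by apply: leq_trans m1m; rewrite leq_max.
have n_gt0 : (0 < #|G|)%N by apply: leq_trans mQ; rewrite expn_gt0 m_gt0.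
(* By maximality of [m], [n ^ (1 / Q) < m + 1 <= 2 * m]. *)
have root_le : #|G|%:R `^ Q%:R^-1 <= 2 * m%:R :> R.
  apply: (@le_trans _ _ m.+1%:R); last by rewrite -natrM ler_nat; lia.
  have -> : m.+1%:R = (m.+1%:R ^+ Q) `^ Q%:R^-1 :> R.
    by rewrite -powR_mulrn ?ler0n // -powRrM mulfV ?pnatr_eq0 // powRr1 // ler0n.
  rewrite ge0_ler_powR ?invr_ge0 ?ler0n // ?nnegrE ?exprn_ge0 ?ler0n //.
  rewrite -natrX ler_nat leqNgt; apply/negP => /ltnW/mmax; by rewrite ltnn.
have n_pos : 0 < #|G|%:R :> R by rewrite ltr0n.
rewrite powRD; last by rewrite (gt_eqF n_pos) implybT.
rewrite powRN powR_mulrn ?ler0n // mulrA ler_pdivlMr ?powR_gt0 //.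
apply: le_trans (ler_wpM2l _ root_le) _; first exact: ler0n.
rewrite mulrCA ler_pM2l // -natrM -natrX ler_nat mulnC.
exact: small.
Qed.
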